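(* Let $X$ be a Hausdorff space, let $\tau^c$ be the family of all closed subsets of $X$ and $\mathcal C_X$ the family of all compact subsets of $X$. Let $Y$ be a Hausdorff space with a strictly increasing closed cover $\{B_n\}_{n\in\mathbb N}$. Then $X$ is a regular $\gamma$-space if and only if there exists a map $\phi:\mathcal C_X\to\mathcal L(X,\mathcal F(Y))$, $K\mapsto\phi_K$, such that: (i) for each $K\in\mathcal C_X$, $K=\bigcap_{n\in\mathbb N}\phi_K^{-1}[Y\setminus B_n]$; (ii) if $K_1,K_2\in\mathcal C_X$ and $K_1\subset K_2$, then $\phi_{K_1}(x)\subset\phi_{K_2}(x)$ for all $x\in X$; (iii) for each $K\in\mathcal C_X$ and $F\in\tau^c$ with $K\cap F=\emptyset$, there exists an open set $V\supset F$ such that $\phi_K$ is bounded on $V$.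
   Context: $\mathbb N$ is the set of positive integers. A sequence $\{B_n\}_{n\in\mathbb N}$ of closed subsets of a space $Y$ is a strictly increasing closed cover of $Y$ if $Y=\bigcup_{n}B_n$, $B_1\neq\emptyset$ and $B_n\subsetneq B_{n+1}$ for each $n$. $\mathcal F(Y)$ is the family of nonempty closed subsets of $Y$. For a set-valued map $\psi:X\to\mathcal F(Y)$ and $B\subset Y$, $\psi^{-1}[B]=\{x\in X:\psi(x)\cap B\neq\emptyset\}$ and $\psi^{\#}[B]=\{x\in X:\psi(x)\subset B\}$. $\psi$ is lower semi-continuous if $\psi^{-1}[V]$ is open in $X$ for each open $V\subset Y$; $\mathcal L(X,\mathcal F(Y))$ is the set of all lower semi-continuous maps $X\to\mathcal F(Y)$. $\psi$ is bounded on $A\subset X$ if $A\subset\psi^{\#}[B_n]$ for some $n\in\mathbb N$. A $g$-function for a space $X$ with topology $\tau$ is a map $g:\mathbb N\times X\to\tau$ such that $x\in g(n,x)$ and $g(n+1,x)\subset g(n,x)$ for all $x\in X$, $n\in\mathbb N$. A space $X$ is a $\gamma$-space if there is a $g$-function $g$ for $X$ such that whenever $y_n\in g(n,x)$ and $x_n\in g(n,y_n)$ for all $n\in\mathbb N$, the point $x$ is a cluster point of the sequence $\langle x_n\rangle$. *)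

(* Defs.v *)
From mathcomp Require Import all_boot.
From mathcomp Require Import mathcomp_extra boolp classical_sets functions.
From mathcomp Require Import topology.

Set Implicit Arguments.
Unset Strict Implicit.
Unset Printing Implicit Defensive.

Local Open Scope classical_set_scope.

(* Sequences indexed by the positive integers are represented by functions on
   [nat], shifted by one: [B 0] is B_1, [B n] is B_(n+1); similarly for the
   first argument of a g-function. *)

Definition strictly_increasing_closed_cover {Y : topologicalType}
    (B : nat -> set Y) : Prop :=
  [/\ forall n, closed (B n),
      \bigcup_n B n = [set: Y],
      B 0 !=set0 &
      forall n, B n `<` B n.+1].

Section set_valued_maps.
Context {X Y : topologicalType}.
Implicit Types (psi : X -> set Y) (B : nat -> set Y) (A : set X) (S : set Y).

Definition nonempty_closed_sets : set (set Y) :=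
  [set C | closed C /\ C !=set0].

(* psi^{-1}[S] *)
Definition meet_preimage psi S : set X := [set x | psi x `&` S !=set0].

(* psi^{#}[S] *)
Definition sub_preimage psi S : set X := [set x | psi x `<=` S].

Definition lower_semicontinuous_setmap psi : Prop :=
  forall V : set Y, open V -> open (meet_preimage psi V).

(* L(X, F(Y)) *)
Definition lsc_maps : set (X -> set Y) :=
  [set psi | (forall x, nonempty_closed_sets (psi x)) /\
             lower_semicontinuous_setmap psi].

Definition bounded_setmap_on B psi A : Prop :=
  exists n, A `<=` sub_preimage psi (B n).

End set_valued_maps.
Arguments nonempty_closed_sets Y : clear implicits.
Arguments lsc_maps X Y : clear implicits.

Definition compact_sets (X : topologicalType) : set (set X) :=
  [set K | compact K].
Arguments compact_sets X : clear implicits.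

Definition g_function {X : topologicalType} (g : nat -> X -> set X) : Prop :=
  forall n x, [/\ open (g n x), g n x x & g n.+1 x `<=` g n x].

Definition gamma_space (X : topologicalType) : Prop :=
  exists g : nat -> X -> set X, g_function g /\
    forall (x : X) (y_ x_ : nat -> X),
      (forall n, g n x (y_ n)) -> (forall n, g n (y_ n) (x_ n)) ->
      cluster (x_ @ \oo) x.

(* Main.v *)
Require Import Defs.
From mathcomp Require Import all_boot.
From mathcomp Require Import mathcomp_extra boolp classical_sets functions.
From mathcomp Require Import cardinality.
From mathcomp Require Import topology.

(** Both conditions say that the compact sets of [X] can be shrunk onto
    uniformly: there are open sets [G n K], decreasing in [n] and increasing in
    the compact set [K], that contain [K] and such that each closed set disjoint
    from [K] has a neighbourhood disjoint from some [G n K]. This is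
    [regular_compact_expansion], and the proof goes through it in both
    directions.

    If [X] is regular and [g] witnesses the gamma property, take for [G n K] the
    union of the [g n x] over [x] in [K]. Around a point [p] of [K], regularity
    puts a closed neighbourhood of [p] off the given closed set, and the gamma
    property says that [g n y] stays inside it for all [y] in [g n p], for some
    [n] ([gamma_function_absorb]); compactness makes [n] uniform on [K]
    ([union_expansion_separates]).

    Conversely, an expansion restricted to points gives regularity at once, and
    [g n x = G n [set x]] is a gamma function: if [y n] lies in [g n x], then [y]
    converges to [x], so that [x] together with a tail of [y] is a compact set
    [K] inside any given neighbourhood of [x]. By monotonicity in [K], the points
    of [g n (y n)] are in [G n K], hence in that neighbourhood for large [n]
    ([expansion_gamma]).

    Finally, expansions and families of lower semi-continuous maps determine each
    other. A family [phi] gives [G n K], the set of the points [x] at which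
    [phi K x] is not contained in [B n]. A decreasing sequence [S] of open sets
    is recovered in this way from the map [cover_level_map B S], sending [x] to
    the intersection of the [B n] for which [x] is outside [S n]: as the cover is
    strictly increasing, a point of [B n.+1] outside [B n] detects [S n]. *)

Local Open Scope classical_set_scope.

(** * Expansions of compact sets *)

Section compact_expansions.
Context {X : topologicalType}.
Implicit Types (G : nat -> set X -> set X) (g : nat -> X -> set X).

Definition regular_compact_expansion G : Prop :=
  [/\ forall n K, compact K -> open (G n K),
      forall n K, compact K -> K `<=` G n K,
      forall n K, compact K -> G n.+1 K `<=` G n K,
      forall n K1 K2, compact K1 -> compact K2 ->
        K1 `<=` K2 -> G n K1 `<=` G n K2 &
      forall K F, compact K -> closed F -> K `&` F = set0 ->
        exists n V, [/\ open V, F `<=` V & V `&` G n K = set0]].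

Lemma nonincreasing_subset {S : nat -> set X} :
  (forall n, S n.+1 `<=` S n) -> forall m n, m <= n -> S n `<=` S m.
Proof.
move=> dS; apply: (@homo_leq _ S (fun C D => D `<=` C)) dS.
  by move=> C; exact: subset_refl.
move=> C2 C1 C3 C21 C32; exact: subset_trans C32 C21.
Qed.

Lemma regular_nbhs_closure {x : X} {U : set X} : @regular_space X -> open U ->
  U x -> exists W, [/\ open W, W x & closure W `<=` U].
Proof.
move=> rX oU Ux.
have [A xA AU] := rX x _ (open_nbhs_nbhs (conj oU Ux)).
exists A°; split; [exact: open_interior|exact: nbhs_singleton (nbhs_interior xA)|].
exact: subset_trans (closureS (@interior_subset _ A)) AU.
Qed.

Definition gamma_function g : Prop := g_function g /\
  forall (x : X) (y_ x_ : nat -> X),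
    (forall n, g n x (y_ n)) -> (forall n, g n (y_ n) (x_ n)) ->
    cluster (x_ @ \oo) x.

(** The sequential form of the gamma property yields a uniform one: if it fails
    for all [n], choosing a bad pair [(y, z)] for each [n] gives a sequence
    outside [W] which would have [x] as a cluster point. *)
Lemma gamma_function_absorb {g} : gamma_function g ->
  forall (x : X) (W : set X), open W -> W x ->
  exists n, forall y, g n x y -> g n y `<=` W.
Proof.
move=> [gg clg] x W oW Wx; apply: contrapT => /forallNP noW.
have bad n : exists p : X * X, [/\ g n x p.1, g n p.1 p.2 & ~ W p.2].
  apply: contrapT => /forallNP bad; apply: (noW n) => y xy z yz.
  by apply: contrapT => nWz; apply: (bad (y, z)).
have [p pP] := choice bad.
have gx n : g n x (p n).1 by case: (pP n).
have gp n : g n (p n).1 (p n).2 by case: (pP n).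
have [|z [nWz /nWz]] // := clg _ _ _ gx gp (~` W) W _ (open_nbhs_nbhs (conj oW Wx)).
by exists 0 => // n _ /=; case: (pP n).
Qed.

(** * From regular gamma-spaces to expansions *)

Definition union_expansion g n (K : set X) : set X := \bigcup_(x in K) g n x.

(** Compactness of [K] is used in the near-covering form, along the product of
    [\oo] and the filter of neighbourhoods of [F]: near each point of [K] and for
    all large [m] and all [z] close to [F], the set [g m q] misses [z]. A uniform
    choice over [K] is then exactly an index and a neighbourhood of [F]. *)
Lemma union_expansion_separates {g} {K F : set X} :
  @regular_space X -> gamma_function g -> compact K -> closed F ->
  K `&` F = set0 ->
  exists n V, [/\ open V, F `<=` V & V `&` union_expansion g n K = set0].
Proof.
move=> rX gg /compact_near_coveringP cK cF KF0.
have [gf _] := gg.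
have := cK _ (filter_prod \oo (set_nbhs F)) (fun i q => ~ g i.1 q i.2).
case=> [p Kp|[S T] /= [[N _ NS] /set_nbhsP[V [oV FV VT]]] ST].
- have Fp : (~` F) p by move=> Fp; have : (K `&` F) p by []; rewrite KF0.
  have [W [oW Wp WF]] := regular_nbhs_closure rX (closed_openC cF) Fp.
  have [n nW] := gamma_function_absorb gg _ _ oW Wp.
  have [ogn gnp _] := gf n p.
  exists (g n p, ([set m | n <= m] `*` ~` closure W)) => /=.
    split; first exact: open_nbhs_nbhs.
    exists ([set m | n <= m], ~` closure W) => //=; split; first by exists n.
    apply/set_nbhsP; exists (~` closure W); split=> //.
      exact: closed_openC (@closed_closure _ _).
    by move=> z Fz /WF.
  move=> [q [m z]] /= [gq [nm nWz]] gz; apply: nWz; apply: subset_closure.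
  apply: nW gq _ _.
  by apply: (@nonincreasing_subset (g^~ q) _ _ _ nm) gz => k; case: (gf k q).
- exists N, V; split=> //; apply/seteqP; split=> // z [Vz [q Kq gz]].
  by apply: (ST (N, z)) Kq gz; split; [exact: NS (leqnn _)|exact: VT].
Qed.

Lemma regular_gamma_expansion : @regular_space X -> gamma_space X ->
  exists G, regular_compact_expansion G.
Proof.
move=> rX [g gg]; have [gf _] := gg; exists (union_expansion g); split.
- by move=> n K _; apply: bigcup_open => x _; case: (gf n x).
- by move=> n K _ x Kx; exists x => //; case: (gf n x).
- by move=> n K _; apply: subset_bigcup => x _; case: (gf n x).
- by move=> n K1 K2 _ _; exact: bigcup_subset.
- by move=> K F; exact: union_expansion_separates.
Qed.

(** * From expansions to regular gamma-spaces *)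

(** The open neighbourhood of the closed set is what gives control of the closure
    of [G n K], and hence regularity. *)
Lemma expansion_base {G K U} : regular_compact_expansion G ->
  compact K -> open U -> K `<=` U -> exists n, closure (G n K) `<=` U.
Proof.
move=> [_ _ _ _ sepG] cK oU KU.
have [||n [V [oV FV VG]]] := sepG K (~` U) cK; first exact: open_closedC.
  by apply/disjoints_subset; rewrite setCK.
exists n.
have /closureS : G n K `<=` ~` V by apply/disjoints_subset; rewrite setIC.
rewrite -(closure_id (~` V)).1; last exact: open_closedC oV.
by move=> /subset_trans; apply; rewrite -[U in _ `<=` U]setCK; exact: subsetC.
Qed.

Lemma expansion_regular {G} : regular_compact_expansion G -> @regular_space X.
Proof.
move=> eG x U xU; have [oG sG _ _ _] := eG.
have cx := @compact_set1 _ x.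
have [|n nU] := expansion_base eG cx (@open_interior _ U); first by move=> _ ->.
exists (G n [set x]); last exact: subset_trans nU (@interior_subset _ U).
exact: open_nbhs_nbhs (conj (oG n _ cx) (sG n _ cx x erefl)).
Qed.

(** A filter that lives on the sequence and its limit, but does not cluster at the
    limit, lives on finitely many terms. *)
Lemma compact_cvg_sequence {y : nat -> X} {x : X} :
  y @ \oo --> x -> compact (x |` range y).
Proof.
move=> yx F FF FK.
have [xF|nxF] := pselect (cluster F x); first by exists x; split=> //; left.
have [A [U [FA xU AU0]]] : exists A U, [/\ F A, nbhs x U & A `&` U = set0].
  apply: contrapT => nAU; apply: nxF => A U FA xU; apply/set0P/eqP => AU0.
  by apply: nAU; exists A, U.
have [N _ NU] := yx _ xU.
have cI : compact (y @` `I_N) by apply/finite_compact/finite_image/finite_II.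
have [|z [[n _ <-] clz]] := cI _ FF; last first.
  by exists (y n); split=> //; right; exists n.
apply: filterS (filterI FA FK) => z [Az [zx|[n _ yn]]].
  suff : (A `&` U) z by rewrite AU0.
  by split=> //; rewrite zx; exact: nbhs_singleton.
exists n => //=; rewrite ltnNge; apply/negP => /NU Uyn.
by suff : (A `&` U) z by [rewrite AU0]; split=> //; rewrite -yn.
Qed.

(** This is where the expansion is needed for compact sets and not for points only:
    the sets [G n [set y n]] have to be controlled simultaneously, and monotonicity
    puts all of them into the sets [G n K] for one compact set [K]. *)
Lemma expansion_gamma {G} : regular_compact_expansion G -> gamma_space X.
Proof.
move=> eG; have [oG sG dG mG _] := eG.
have cx (p : X) : compact [set p] by exact: compact_set1.
exists (fun n x => G n [set x]); split.
  by move=> n x; split; [exact: oG|exact: sG|exact: dG].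
move=> x y z gy gz.
have anti K (cK : compact K) := @nonincreasing_subset (G^~ K) (fun n => dG n K cK).
have yx : y @ \oo --> x.
  move=> U; rewrite nbhsE => -[W [oW Wx] WU].
  have [|n nW] := expansion_base eG (cx x) oW; first by move=> _ ->.
  exists n => // m nm; apply/WU/nW/subset_closure.
  exact: anti nm _ (gy m).
have zx : z @ \oo --> x.
  move=> U; rewrite nbhsE => -[W [oW Wx] WU].
  have [N _ NW] := yx _ (open_nbhs_nbhs (conj oW Wx)).
  (* Dropping the first [N] terms makes the compact set lie in [W]. *)
  have yNx : (fun n => y (n + N)) @ \oo --> x.
    by move=> A /yx[M _ MA]; exists M => // k Mk; exact/MA/(leq_trans Mk)/leq_addr.
  have cK := compact_cvg_sequence yNx.
  have [|n nW] := expansion_base eG cK oW.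
    by move=> _ [->//|[k _ <-]]; apply: NW; exact: leq_addl.
  exists (maxn n N) => // m; rewrite /= geq_max => /andP[nm Nm].
  apply/WU/nW/subset_closure/(anti _ cK _ _ nm).
  apply: mG (gz m) => // _ ->; right; exists (m - N) => //=.
  by rewrite subnK.
move=> A U zA xU.
exact: (@filter_ex _ (z @ \oo)) (filterI zA (zx _ xU)).
Qed.

End compact_expansions.

(** * Decreasing sequences of open sets as set-valued maps *)

Section cover.
Context {X Y : topologicalType}.

(** This is the intersection of the [B n] over the [n] with [~ S n x], written
    pointwise, so that monotonicity in [S] is immediate. *)
Definition cover_level_map (B : nat -> set Y) (S : nat -> set X)
    (x : X) : set Y :=
  [set y | forall n, ~ B n y -> S n x].

Context {B : nat -> set Y}.
Hypothesis hB : strictly_increasing_closed_cover B.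

Lemma cover_nondecreasing {m n : nat} : m <= n -> B m `<=` B n.
Proof.
move: m n; apply: (@homo_leq _ B (fun C D => C `<=` D)).
- by move=> C; exact: subset_refl.
- by move=> C2 C1 C3; exact: subset_trans.
- by have [_ _ _ sB] := hB => n; case: (sB n).
Qed.

Lemma cover_level_map_nonempty_closed S x :
  nonempty_closed_sets Y (cover_level_map B S x).
Proof.
have [cB _ [y By] sB] := hB; split.
  rewrite [X in closed X](_ : _ = \bigcap_(n in [set n | ~ S n x]) B n).
    by apply: closed_bigI.
  apply/seteqP; split=> z zS n.
    by move=> nS; apply: contrapT => /zS.
  by apply: contra_notP => nS; exact: zS.
exists y => n nB; exfalso; apply: nB.
exact: cover_nondecreasing (leq0n n) _ By.
Qed.

Lemma meet_preimage_cover_level_map S n : (forall n, S n.+1 `<=` S n) ->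
  meet_preimage (cover_level_map B S) ([set: Y] `\` B n) = S n.
Proof.
move=> dS; apply/seteqP; split=> [x [y [yS [_ nBy]]]|x Sx]; first exact: yS.
have [_ _ _ /(_ n)[_ /nonsubset[y [BSy nBy]]]] := hB.
exists y; split=> // m nBm; apply: nonincreasing_subset dS _ _ _ _ Sx.
by rewrite leqNgt; apply/negP => nm; apply/nBm/(cover_nondecreasing nm).
Qed.

(** The points [x] whose image contains a given [y] always form an open set, so the
    preimage of every subset of [Y] is open: for the least [k] with [B k y], the
    condition on [x] is vacuous if [k] is zero and otherwise, [S] being decreasing,
    amounts to [S k.-1 x]. *)
Lemma cover_level_map_lsc S : (forall n, open (S n)) ->
  (forall n, S n.+1 `<=` S n) ->
  lower_semicontinuous_setmap (cover_level_map B S).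
Proof.
move=> oS dS V _; have [_ cB _ _] := hB.
rewrite [X in open X](_ : _ = \bigcup_(y in V)
    [set x | cover_level_map B S x y]); last first.
  by apply/seteqP; split=> x [y] => [[yx Vy]|Vy yx]; exists y.
apply: bigcup_open => y _.
have [k Bky kmin] : exists2 k, B k y & forall m, B m y -> k <= m.
  have ex : exists n, `[< B n y >].
    by have [n _ Bn] : (\bigcup_n B n) y by [rewrite cB]; exists n; apply/asboolP.
  by case: (ex_minnP ex) => k /asboolP ? kmin; exists k => // m /asboolP/kmin.
case: k Bky kmin => [|k] Bky kmin.
  rewrite [X in open X](_ : _ = setT); first exact: openT.
  apply/seteqP; split=> // x _ n nBn; exfalso.
  exact/nBn/(cover_nondecreasing (leq0n n)).
rewrite [X in open X](_ : _ = S k); first exact: oS.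
apply/seteqP; split=> x /=; first by apply=> /kmin; rewrite ltnn.
move=> Sx n nBn; apply: nonincreasing_subset dS _ _ _ _ Sx.
by rewrite leqNgt; apply/negP => /cover_nondecreasing/(_ _ Bky).
Qed.

End cover.

(** * Expansions and separating families *)

Section correspondence.
Context {X Y : topologicalType} {B : nat -> set Y}.
Hypothesis hB : strictly_increasing_closed_cover B.

Definition separating_lsc_family (phi : {fun compact_sets X >-> lsc_maps X Y}) :=
    [/\ forall K : set X, compact_sets X K ->
          K = \bigcap_n meet_preimage (phi K) ([set: Y] `\` B n),
        forall K1 K2 : set X, compact_sets X K1 -> compact_sets X K2 ->
          K1 `<=` K2 -> forall x, phi K1 x `<=` phi K2 x &
        forall K F : set X, compact_sets X K -> closed F ->
          K `&` F = set0 ->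
          exists V : set X,
            [/\ open V, F `<=` V & bounded_setmap_on B (phi K) V]].

Lemma separating_family_expansion {phi} : separating_lsc_family phi ->
  regular_compact_expansion
    (fun n K => meet_preimage (phi K) ([set: Y] `\` B n)).
Proof.
move=> [eqK mphi sep]; split.
- move=> n K /(@funS _ _ _ _ phi) [_ lphi]; apply: lphi; rewrite setTD.
  by apply: closed_openC; case: hB.
- by move=> n K cK x; rewrite [K in K x]eqK// => /(_ n I).
- move=> n K _ x [y [Ky [_ nBy]]]; exists y; split=> //; split=> // By.
  exact: nBy (cover_nondecreasing hB (leqnSn n) _ By).
- move=> n K1 K2 c1 c2 K12 x [y [Ky nBy]]; exists y; split=> //.
  exact: mphi K12 _ _ Ky.
- move=> K F cK cF /(sep _ _ cK cF)[V [oV FV [n Vn]]]; exists n, V; split=> //.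
  by apply/seteqP; split=> // x [/Vn Bn [y [/Bn]] By []].
Qed.

(** The sets [G n K] intersect exactly in [K]: a point outside [K] is a closed set,
    since [X] is Hausdorff, and is separated from some [G n K]. *)
Lemma expansion_separating_family {G} : hausdorff_space X ->
  @regular_compact_expansion X G -> exists phi, separating_lsc_family phi.
Proof.
move=> hX eG; have [oG sG dG mG sepG] := eG.
have phiP : {homo (fun K => cover_level_map B (G^~ K)) :
    K / compact_sets X K >-> lsc_maps X Y K}.
  move=> K cK; split; first by move=> x; exact: cover_level_map_nonempty_closed.
  by apply: cover_level_map_lsc => // n; [exact: oG|exact: dG].
exists [fun of mkfun phiP]; split=> /=.
- move=> K cK; apply/seteqP; split=> x.
    move=> Kx n _; rewrite meet_preimage_cover_level_map => //.
      exact: sG.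
    by move=> m; exact: dG.
  move=> Gx; apply: contrapT => nKx.
  have [||n] := expansion_base eG cK (U := ~` [set x]).
  + exact/closed_openC/accessible_closed_set1/hausdorff_accessible.
  + by move=> z Kz zx; apply: nKx; rewrite -zx.
  move=> /(_ x) nG; apply: (nG _ erefl); apply: subset_closure.
  have := Gx n I; rewrite meet_preimage_cover_level_map => //.
  by move=> m; exact: dG.
- by move=> K1 K2 c1 c2 K12 x y yx n /yx; exact: mG.
- move=> K F cK cF /(sepG _ _ cK cF)[n [V [oV FV VG]]]; exists V; split=> //.
  exists n => x Vx y yx; apply: contrapT => /yx Gx.
  by suff : (V `&` G n K) x by rewrite VG.
Qed.

End correspondence.

Theorem theorem2p4 (X Y : topologicalType) (B : nat -> set Y)
    (hX : hausdorff_space X) (hY : hausdorff_space Y)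
    (hB : strictly_increasing_closed_cover B) :
  (@regular_space X /\ gamma_space X) <->
  exists phi : {fun compact_sets X >-> lsc_maps X Y},
    [/\ forall K : set X, compact_sets X K ->
          K = \bigcap_n meet_preimage (phi K) ([set: Y] `\` B n),
        forall K1 K2 : set X, compact_sets X K1 -> compact_sets X K2 ->
          K1 `<=` K2 -> forall x, phi K1 x `<=` phi K2 x &
        forall K F : set X, compact_sets X K -> closed F ->
          K `&` F = set0 ->
          exists V : set X,
            [/\ open V, F `<=` V & bounded_setmap_on B (phi K) V]].
Proof.
split=> [[rX gX]|[phi sphi]].
  have [G eG] := regular_gamma_expansion rX gX.
  by have [phi sphi] := expansion_separating_family hB hX eG; exists phi.
have eG := separating_family_expansion hB sphi.
by split; [exact: expansion_regular eG|exact: expansion_gamma eG].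
Qed.
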